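(* Let $G$ be a torsion abelian group. Then the following conditions are equivalent: (a) $\widetilde s(G)=0$ (equivalently, $\widetilde{s_0}(G)=0$); (b) $s(G)=0$ (equivalently, $s_0(G)=0$); (c) $t_p(G)$ is finite for every prime $p$. In particular, $\widetilde s(G)=\widetilde{s_0}(G)$.
   Context: $\mathbb N=\{0,1,2,\dots\}$ and $\mathbb N_+=\mathbb N\setminus\{0\}$. Let $\phi$ be an endomorphism of an abelian group $G$. A string of $\phi$ is a sequence $S=\{x_n\}_{n\in\mathbb N}$ of pairwise distinct elements of $G$ such that $\phi(x_n)=x_{n-1}$ for every $n\in\mathbb N_+$. It is a null string if $x_0\neq 0$ and $\phi^k(x_0)=0$ for some $k\in\mathbb N_+$. Define $s(\phi)$ (respectively $s_0(\phi)$) as the supremum of the cardinalities $|\mathcal F|$, where $\mathcal F$ ranges over the families of pairwise disjoint strings (respectively null strings) of $\phi$; if this supremum is infinite it is set equal to the symbol $\infty$. For an abelian group $G$, $s(G)=\sup\{s(\phi):\phi\in\mathrm{End}(G)\}$ and $s_0(G)=\sup\{s_0(\phi):\phi\in\mathrm{End}(G)\}$. Moreover $\widetilde s(G)=\sup\{s(H):H\leq G\}$ and $\widetilde{s_0}(G)=\sup\{s_0(H):H\leq G\}$, where $H$ ranges over all subgroups of $G$. $t_p(G)$ is the $p$-component of $G$. *)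

(* Defs.v *)
(* MathComp / MathComp-Analysis. *)
From HB Require Import structures.
From mathcomp Require Import all_boot all_order all_algebra.
From mathcomp Require Import all_classical all_reals all_analysis.

Set Implicit Arguments.
Unset Strict Implicit.
Unset Printing Implicit Defensive.

Import Order.TTheory GRing.Theory Num.Theory.

Local Open Scope classical_set_scope.
Local Open Scope ring_scope.

Definition torsion_group (G : zmodType) : Prop :=
  forall x : G, exists2 n : nat, (0 < n)%N & x *+ n = 0.

Definition p_component (G : zmodType) (p : nat) : set G :=
  [set x | exists k : nat, x *+ (p ^ k)%N = 0].

Definition is_string (G : zmodType) (phi : {additive G -> G})
    (x : nat -> G) : Prop :=
  injective x /\ forall n : nat, phi (x n.+1) = x n.

Definition is_null_string (G : zmodType) (phi : {additive G -> G})
    (x : nat -> G) : Prop :=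
  [/\ is_string phi x, x 0%N != 0
    & exists2 k : nat, (0 < k)%N & iter k phi (x 0%N) = 0].

Definition disjoint_family (T : Type) (P F : set (nat -> T)) : Prop :=
  F `<=` P /\ trivIset F (fun x : nat -> T => range x).

(* All suprema below are of nonempty sets of values in {0, 1, 2, ..., +oo}.
   [counting F] is the cardinality of F when F is finite and +oo otherwise,
   so an infinite supremum is always the single symbol +oo. *)
Section StringNumbers.
Variable R : realType.
Implicit Type G : zmodType.
Local Open Scope ereal_scope.

Definition string_number G (phi : {additive G -> G}) : \bar R :=
  ereal_sup [set counting F | F in disjoint_family (is_string phi)].

Definition null_string_number G (phi : {additive G -> G}) : \bar R :=
  ereal_sup [set counting F | F in disjoint_family (is_null_string phi)].

Definition s G : \bar R :=
  ereal_sup (range (fun phi : {additive G -> G} => string_number phi)).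

Definition s0 G : \bar R :=
  ereal_sup (range (fun phi : {additive G -> G} => null_string_number phi)).

End StringNumbers.

Arguments s R G : clear implicits.
Arguments s0 R G : clear implicits.

(* A subgroup of G, as a group in its own right.  Classically every subset is
   a boolean predicate, so [zmodClosed G] ranges over all subgroups of G. *)
Definition subgroup (G : zmodType) (H : zmodClosed G) := {x : G | x \in H}.

HB.instance Definition _ (G : zmodType) (H : zmodClosed G) :=
  SubChoice.on (subgroup H).
HB.instance Definition _ (G : zmodType) (H : zmodClosed G) :=
  [SubChoice_isSubZmodule of subgroup H by <:].

Definition tilde_s (R : realType) (G : zmodType) : \bar R :=
  ereal_sup (range (fun H : zmodClosed G => s R (subgroup H))).

Definition tilde_s0 (R : realType) (G : zmodType) : \bar R :=
  ereal_sup (range (fun H : zmodClosed G => s0 R (subgroup H))).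

(* Main.v *)
From HB Require Import structures.
Require Import Defs.
From mathcomp Require Import all_boot all_order all_algebra.
From mathcomp Require Import all_classical all_reals all_analysis.

Set Implicit Arguments.
Unset Strict Implicit.
Unset Printing Implicit Defensive.

Import Order.TTheory GRing.Theory Num.Theory.

Local Open Scope classical_set_scope.
Local Open Scope ring_scope.

(** Suppose first that every primary component is finite, and let [x] be a string
of [phi]; let [N] kill [x 0].  If some [x n] were not killed by [N], the first
such [n] would give a nonzero element [N x_n] of [ker phi] that has arbitrarily
long chains of preimages.  A suitable multiple [z] of it has prime order [p], and
the preimages of [z] can be moved into the [p]-component.  A preimage [w k] of [z]
under [phi^k] satisfies [phi^(k+1) (w k) = 0], hence the [w k] are pairwise
distinct, which is absurd in a finite component.  So the whole string lies in the
subgroup killed by [N], which is finite: no string exists ([no_string]), in [G]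
or in any of its subgroups, and all four numbers vanish.

Suppose now that the [p]-component is infinite.  It is enough to find an
endomorphism [phi] of [G] and [x 0 != 0] in [ker phi] with an infinite backward
orbit [x n], called a socle string below.  Indeed the sequences
[n |-> x n + x (n + i + 1)] are then infinitely many pairwise disjoint null
strings, so that [s0 G], and with it [s G] and both tilde numbers, are infinite.
In particular none of these numbers takes a finite nonzero value.

To find [phi], put [S n = (p^n G)[p]], the elements of [p^n G] killed by [p].
- If some [S n / S n.+1] is infinite, infinitely many elements [c k] of order
  [p^n.+1] are independent modulo [p^n.+1 G].  The shift [c k.+1 |-> c k],
  [c 0 |-> 0] of their span extends to [G] ([homogeneous_socle_string]).
- If [S n != S n.+1] for infinitely many [n], there are [c k] of rapidly growing
  orders [p^(m k)], each generating a direct summand.  Homomorphisms [f k] from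
  [G] to the group generated by [c k], with [f k (c k.+1) = c k], can be chosen so
  that only finitely many of them are nonzero at a given element, and [phi] is
  their sum ([unbounded_socle_string]).
- If [S n] is eventually constant and nonzero, the [p]-component of [p^n G] is
  divisible for large [n], and [phi] is multiplication by [p]
  ([divisible_socle_string]).
- Otherwise [S n = 0] for some [n] and the quotients are finite, so [G[p]] is
  finite and [p^n] kills the [p]-component, which is then finite.
The first two cases rest on an extension theorem for homomorphisms into a sum of
cyclic groups of the same order [p^n] ([extend_hom]), in the spirit of Baer's
criterion.  Working in [G] itself rather than in its [p]-component gives
endomorphisms of [G] at once. *)

(** * Strings that end in the kernel *)

Lemma iter_additive0 (A : zmodType) (phi : {additive A -> A}) n :
  iter n phi 0 = 0.
Proof. by elim: n => //= n ->; rewrite raddf0. Qed.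

Lemma iter_additiveD (A : zmodType) (phi : {additive A -> A}) n x y :
  iter n phi (x + y) = iter n phi x + iter n phi y.
Proof. by elim: n => //= n ->; rewrite raddfD. Qed.

Lemma iter_additiveMn (A : zmodType) (phi : {additive A -> A}) n x m :
  iter n phi (x *+ m) = iter n phi x *+ m.
Proof. by elim: n => //= n ->; rewrite raddfMn. Qed.

(** A null string continued down to the last nonzero iterate of its first term; that
iterate lies in the kernel of [phi]. *)
Definition socle_string (A : zmodType) (phi : {additive A -> A})
    (x : nat -> A) : Prop :=
  [/\ x 0%N != 0, phi (x 0%N) = 0 & forall n, phi (x n.+1) = x n].

(** The exponent [n.+1] is the first one that kills [w n], so it can be recovered
from the value [w n].  The [w n] need not be consecutive preimages. *)
Lemma iterated_preimage_inj (A : zmodType) (phi : {additive A -> A}) z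
    (w : nat -> A) :
  z != 0 -> phi z = 0 -> (forall n, iter n phi (w n) = z) -> injective w.
Proof.
move=> /eqP z0 phiz wz.
have lt_neq n m : (n < m)%N -> w n <> w m.
  move=> nm e; apply: z0; rewrite -(wz m) -e -(subnK nm) iterD /=.
  by rewrite wz phiz iter_additive0.
by move=> n m e; case: (ltngtP n m) => // /lt_neq; [move/(_ e)|move/(_ (esym e))].
Qed.

Lemma iter_string (A : zmodType) (phi : {additive A -> A}) (x : nat -> A) :
  (forall n, phi (x n.+1) = x n) -> forall m n, iter m phi (x (n + m)%N) = x n.
Proof.
by move=> xS; elim=> [|m IH] n; rewrite ?addn0 // iterSr addnS xS IH.
Qed.

Lemma iter_socle_string (A : zmodType) (phi : {additive A -> A}) x :
  socle_string phi x -> forall m n, (n < m)%N -> iter m phi (x n) = 0.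
Proof.
move=> [_ x0 xS] m n nm; rewrite -(subnK nm) iterD /=.
by have := iter_string xS n 0; rewrite add0n => ->; rewrite x0 iter_additive0.
Qed.

Lemma socle_string_inj (A : zmodType) (phi : {additive A -> A}) x :
  socle_string phi x -> injective x.
Proof.
move=> [x0 px0 xS]; apply: (iterated_preimage_inj x0 px0) => n.
by have := iter_string xS n 0; rewrite add0n.
Qed.

Definition string_translate (A : zmodType) (x : nat -> A) (i n : nat) : A :=
  x n + x (n + i.+1)%N.

(** The number of iterations of [phi] needed to kill [string_translate x i n] is
[n + i + 2], as for its leading term [x (n + i.+1)].  Equal values thus have equal
leading terms, and comparing the remaining terms gives [n = m]. *)
Lemma string_translate_inj (A : zmodType) (phi : {additive A -> A}) x :
    socle_string phi x -> forall i j n m,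
  string_translate x i n = string_translate x j m -> n = m /\ i = j.
Proof.
move=> sx; have [/eqP x0 _ xS] := sx.
have height i j n m : string_translate x i n = string_translate x j m ->
    (m + j <= n + i)%N.
  move=> e; rewrite leqNgt; apply/negP => lt; apply: x0.
  have := congr1 (iter (m + j.+1) phi) e.
  have := iter_string xS (m + j.+1) 0; rewrite add0n !iter_additiveD => ->.
  rewrite !(iter_socle_string sx) ?add0r//; first by rewrite addnS ltnS leq_addr.
  - by rewrite !addnS ltnS.
  - by rewrite addnS ltnS (leq_trans (leq_addr i n)) // ltnW.
move=> i j n m e.
have e' : (n + i)%N = (m + j)%N by apply/eqP; rewrite eqn_leq !height.
have nm : n = m.
  move: e; rewrite /string_translate !addnS e' => /addIr e.
  exact: (socle_string_inj sx).
by split=> //; move: e'; rewrite nm => /addnI.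
Qed.

Lemma string_translate_null (A : zmodType) (phi : {additive A -> A}) x i :
  socle_string phi x -> is_null_string phi (string_translate x i).
Proof.
move=> sx; have [x0 px0 xS] := sx; split.
- split; first by move=> n m /(string_translate_inj sx)[].
  by move=> n; rewrite raddfD addSn !xS.
- apply/eqP => /(congr1 (iter i.+1 phi)).
  rewrite iter_additive0 iter_additiveD (iter_string xS).
  by rewrite (iter_socle_string sx) // add0r; apply/eqP.
- exists i.+2 => //.
  by rewrite iter_additiveD !(iter_socle_string sx) ?addr0 ?add0n.
Qed.

Lemma null_string_number_pinfty (R : realType) (A : zmodType)
    (phi : {additive A -> A}) x :
  socle_string phi x -> null_string_number R phi = +oo%E.
Proof.
move=> sx; apply/eqP; rewrite -leye_eq; apply: ereal_sup_ubound.
exists (range (string_translate x)); last first.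
  rewrite /counting asboolF// => fin; apply: infinite_nat.
  have inj : injective (string_translate x).
    by move=> i j /(congr1 (fun f => f 0%N))/(string_translate_inj sx)[].
  apply: sub_finite_set (finite_preimage (in2W inj) fin) => i _ /=.
  by exists i.
split; first by move=> _ [i _ <-]; exact: string_translate_null.
move=> _ _ [i _ <-] [j _ <-] [z [[n _ <-] [m _]]].
by move=> /(string_translate_inj sx)[_ ->].
Qed.

(** On a set mapped by [phi] onto a superset of itself, preimages can be chosen
forever. *)
Lemma socle_string_of_surj (A : zmodType) (phi : {additive A -> A})
    (S : set A) x0 :
    (forall y, S y -> exists2 z, S z & phi z = y) ->
  S x0 -> x0 != 0 -> phi x0 = 0 -> exists x, socle_string phi x.
Proof.
move=> Ssurj Sx0 x0N0 phix0.
have /choice[lift liftP] : forall y, exists z, S y -> S z /\ phi z = y.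
  move=> y; case: (pselect (S y)) => [/Ssurj[z Sz <-]|nSy].
    by exists z.
  by exists 0.
have Sx n : S (iter n lift x0).
  by elim: n => //= n /liftP[].
by exists (fun n => iter n lift x0); split=> // n /=; have [] := liftP _ (Sx n).
Qed.

(** * Subgroups, multiples and torsion *)

(** The gcd of [a] and a prime power is again a power of [p]. *)
Lemma bezout_prime_pow (p m : nat) (a : int) : prime p ->
  exists i r q, [/\ (i <= m)%N, ((p ^ i)%:Z %| a)%Z
    & r * a + q * (p ^ m)%:Z = (p ^ i)%:Z].
Proof.
move=> p_prime.
have [i im gE] : exists2 i, (i <= m)%N & gcdn `|a| (p ^ m) = (p ^ i)%N.
  by apply/dvdn_pfactor => //; rewrite dvdn_gcdr.
have gE' : gcdz a (p ^ m)%:Z = (p ^ i)%:Z by rewrite /gcdz gE.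
have [r [q rq]] := Bezoutz a (p ^ m)%:Z.
by exists i, r, q; split; rewrite // -gE' ?dvdz_gcdl.
Qed.

Lemma dvdz_pow_cancel (p i j : nat) (a : int) : prime p -> (i <= j)%N ->
  ((p ^ j)%:Z %| a * (p ^ (j - i))%:Z)%Z -> ((p ^ i)%:Z %| a)%Z.
Proof.
move=> p_prime ij; have -> : (p ^ j)%:Z = (p ^ i)%:Z * (p ^ (j - i))%:Z.
  by rewrite -PoszM -expnD subnKC.
by rewrite dvdz_mul2r // eqz_nat -lt0n expn_gt0 prime_gt0.
Qed.

Definition is_subgroup (A : zmodType) (S : set A) : Prop :=
  S 0 /\ forall x y, S x -> S y -> S (x - y).

Section Subgroups.
Variables (A : zmodType) (S : set A).
Hypothesis sS : is_subgroup S.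

Lemma subgroupN x : S x -> S (- x).
Proof. by case: sS => S0 SB /(SB 0 x S0); rewrite sub0r. Qed.

Lemma subgroupD x y : S x -> S y -> S (x + y).
Proof. by move=> Sx /subgroupN Sy; rewrite -[y]opprK; apply: sS.2. Qed.

Lemma subgroupMn x n : S x -> S (x *+ n).
Proof.
by move=> Sx; elim: n => [|n IH]; [exact: sS.1|rewrite mulrS; exact: subgroupD].
Qed.

Lemma subgroupMz x (k : int) : S x -> S (x *~ k).
Proof.
case: k => k Sx; first exact: subgroupMn.
by rewrite NegzE mulrNz; apply/subgroupN/subgroupMn.
Qed.

Lemma subgroup_sum (I : Type) (r : seq I) (F : I -> A) :
  (forall i, S (F i)) -> S (\sum_(i <- r) F i).
Proof.
move=> SF; elim/big_rec: _ => [|i x _ Sx]; first exact: sS.1.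
exact: subgroupD.
Qed.

End Subgroups.

Definition multiples (A : zmodType) (m : nat) : set A :=
  [set x | exists g, x = g *+ m].

Lemma multiples_subgroup (A : zmodType) m : is_subgroup (@multiples A m).
Proof.
split; first by exists 0; rewrite mul0rn.
by move=> _ _ [g ->] [h ->]; exists (g - h); rewrite mulrnBl.
Qed.

Definition torsion_layer (A : zmodType) (m : nat) : set A := [set x | x *+ m = 0].

Lemma torsion_layer_subgroup (A : zmodType) m : is_subgroup (@torsion_layer A m).
Proof.
split; first by rewrite /torsion_layer /= mul0rn.
by move=> x y xm ym; rewrite /torsion_layer /= mulrnBl xm ym subr0.
Qed.

Lemma multiplesMn (A : zmodType) m n (x : A) :
  multiples m x -> multiples (m * n) (x *+ n).
Proof. by move=> [g ->]; exists g; rewrite mulrnA. Qed.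

(** Multiplication by [m] maps [A[m n]] to [A[n]], with fibres that are cosets of
[A[m]]. *)
Lemma finite_torsion_layerM (A : zmodType) m n :
  finite_set (@torsion_layer A m) -> finite_set (@torsion_layer A n) ->
  finite_set (@torsion_layer A (m * n)).
Proof.
move=> fm fn.
have /choice[root rootP] : forall y : A, exists x, multiples m y -> x *+ m = y.
  move=> y; case: (pselect (multiples m y)) => [[g ->]|h]; first by exists g.
  by exists 0.
apply: sub_finite_set (finite_image2 (fun y z => root y + z) fn fm) => x xmn.
exists (x *+ m); first by rewrite /torsion_layer /= -mulrnA.
exists (x - root (x *+ m)); last by rewrite addrC subrK.
by rewrite /torsion_layer /= mulrnBl rootP ?subrr //; exists x.
Qed.

Lemma finite_torsion_layer_pow (A : zmodType) p N :
  finite_set (@torsion_layer A p) -> finite_set (@torsion_layer A (p ^ N)).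
Proof.
move=> fp; elim: N => [|N IH]; last by rewrite expnS; exact: finite_torsion_layerM.
by apply: sub_finite_set (finite_set1 0) => x; rewrite expn0 /torsion_layer /= mulr1n.
Qed.

Lemma finite_torsion_layer (A : zmodType) n : (0 < n)%N ->
  (forall p, prime p -> finite_set (@p_component A p)) ->
  finite_set (@torsion_layer A n).
Proof.
move=> n0 finp; elim/ltn_ind: n n0 => n IH n0.
case: (ltngtP n 1) => [|n1|->]; first by case: n n0 {IH}.
  have pn := pdiv_prime n1; rewrite -(divnK (pdiv_dvd n)).
  apply: finite_torsion_layerM.
    by apply: IH; rewrite ?ltn_Pdiv ?prime_gt1 // divn_gt0 ?pdiv_gt0 // pdiv_leq.
  by apply: sub_finite_set (finp _ pn) => x xp; exists 1%N; rewrite expn1.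
by apply: sub_finite_set (finite_set1 0) => x; rewrite /torsion_layer /= mulr1n.
Qed.

(** * Extension of homomorphisms into homogeneous groups *)

(** The hypothesis [T_homogeneous] holds when [T] is a direct sum of cyclic groups of
order [p ^ n]: every element of [T] that could be divisible by [p ^ j] is. *)
Section Extension.
Variables (A B : zmodType) (p n : nat) (T : set B).
Hypothesis p_prime : prime p.
Hypothesis sT : is_subgroup T.
Hypothesis T_homogeneous : forall j y, (j <= n)%N -> T y ->
  y *+ (p ^ (n - j)) = 0 -> exists2 z, T z & y = z *+ (p ^ j).

(** Graphs of homomorphisms into [T], defined on a subgroup of [A], whose common
extension to the sum of that subgroup and [p ^ n A] by zero on [p ^ n A] is well
defined.  The last clause contains single-valuedness, the case [u.1 = 0]. *)
Let partial_hom (D : set (A * B)) : Prop :=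
  [/\ is_subgroup D, forall u, D u -> T u.2
    & forall u, D u -> multiples (p ^ n) u.1 -> u.2 = 0].

(** The graph [D] is kept apart from the chain so that an empty chain also has an
upper bound. *)
Lemma partial_hom_chain (D : set (A * B)) (F : set (set (A * B))) :
    partial_hom D -> F `<=` [set M | partial_hom (D `|` M)] ->
    total_on F subset ->
  partial_hom (D `|` \bigcup_(M in F) M).
Proof.
move=> hD FP Ftot; set W := \bigcup_(M in F) M.
have pair u v : (D `|` W) u -> (D `|` W) v ->
    exists M, [/\ partial_hom (D `|` M), M `<=` W, (D `|` M) u & (D `|` M) v].
  have inW M : F M -> M `<=` W by move=> FM x Mx; exists M.
  move=> [Du|[M FM Mu]] [Dv|[N FN Nv]].
  - by exists set0; split; rewrite ?setU0.
  - by exists N; split; [exact: FP|exact: inW|left|right].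
  - by exists M; split; [exact: FP|exact: inW|right|left].
  - have [MN|NM] := Ftot _ _ FM FN.
      by exists N; split; [exact: FP|exact: inW|right; exact: MN|right].
    by exists M; split; [exact: FP|exact: inW|right|right; exact: NM].
split.
- split; first by left; case: hD => -[].
  move=> u v hu hv; have [M [[[_ MB] _ _] MW Mu Mv]] := pair u v hu hv.
  by have [?|/MW?] := MB _ _ Mu Mv; [left|right].
- by move=> u hu; have [M [[_ MT _] _ Mu _]] := pair u u hu hu; exact: MT.
- by move=> u hu; have [M [[_ _ M0] _ Mu _]] := pair u u hu hu; exact: M0.
Qed.

(** Let [p ^ j] be the least power with [p ^ j a] in the domain of [D] modulo
[p ^ n A], say [p ^ j a = - u.1] modulo [p ^ n A].  The value at [a] must be a
[p ^ j]-th part of [- u.2]; it exists by homogeneity, because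
[p ^ (n - j) u.1] lies in [p ^ n A] and so [p ^ (n - j) u.2 = 0].  By minimality of
[j], every multiple of [a] in the domain modulo [p ^ n A] is a multiple of
[p ^ j a], so this value meets all the constraints. *)
Lemma partial_hom_step (D : set (A * B)) (a : A) : partial_hom D ->
  exists E, [/\ partial_hom E, D `<=` E & exists t, E (a, t)].
Proof.
move=> [sD DT D0].
have sM := @multiples_subgroup A (p ^ n).
pose hits j := `[< exists2 u, D u & multiples (p ^ n) (u.1 + a *+ (p ^ j)) >].
have hits_n : hits n.
  by apply/asboolP; exists 0; [exact: sD.1|exists a; rewrite add0r].
case: (ex_minnP (ex_intro hits n hits_n)) => j /asboolP[u Du uM] jmin.
have jn : (j <= n)%N by exact: jmin.
have [|z Tz uz] := T_homogeneous jn (DT _ Du).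
  rewrite -(raddfMn snd); apply: D0; first exact: subgroupMn.
  rewrite (raddfMn fst).
  have -> : u.1 *+ p ^ (n - j) = (u.1 + a *+ p ^ j) *+ p ^ (n - j) - a *+ p ^ n.
    by rewrite mulrnDl -mulrnA -expnD subnKC // addrK.
  by apply: sM.2; [exact: subgroupMn|exists a].
exists [set v | exists2 w, D w & exists k : int, v = w + (a *~ k, - z *~ k)].
split; first split.
- split.
    by exists 0; [exact: sD.1|exists 0; rewrite !mulr0z addr0].
  move=> _ _ [v Dv [k ->]] [w Dw [l ->]]; exists (v - w); first exact: sD.2.
  exists (k - l); rewrite opprD addrACA; congr (_ + _).
  by congr pair; rewrite mulrzBr.
- move=> _ [v Dv [k ->]] /=; apply: (subgroupD sT); first exact: DT.
  exact/(subgroupMz sT)/(subgroupN sT).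
- move=> _ [v Dv [k ->]] /= vM.
  have [l kE] : exists l, k = l * (p ^ j)%:Z.
    apply/dvdzP.
    have [i [r [q [_ ik rq]]]] := bezout_prime_pow n k p_prime.
    apply: dvdz_trans ik.
    rewrite dvdzE /= dvdn_exp2l //; apply: jmin; apply/asboolP.
    exists (v *~ r); first exact: subgroupMz.
    have -> : (v *~ r).1 + a *+ p ^ i = (v.1 + a *~ k) *~ r + (a *~ q) *+ p ^ n.
      rewrite (raddfMz fst) mulrzDl -addrA; congr (_ + _).
      by rewrite !pmulrn -rq mulrzDr -!mulrzA [k * r]mulrC.
    by apply: (subgroupD sM); [exact: subgroupMz|exists (a *~ q)].
  have vl : v.2 = u.2 *~ l.
    apply/eqP; rewrite -subr_eq0; apply/eqP.
    rewrite -(raddfMz snd) -(raddfB snd); apply: D0.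
      by apply: sD.2 => //; exact: subgroupMz.
    rewrite (raddfB fst) (raddfMz fst).
    have -> : v.1 - u.1 *~ l = (v.1 + a *~ k) - (u.1 + a *+ p ^ j) *~ l.
      by rewrite mulrzDl kE mulrC mulrzA pmulrn opprD addrACA addrN addr0.
    by apply: sM.2 => //; exact: subgroupMz.
  by rewrite vl uz kE mulrC mulrzA pmulrn mulNrz mulNrz addrN.
- by move=> v Dv; exists v => //; exists 0; rewrite !mulr0z addr0.
- exists (- z); exists 0; first exact: sD.1.
  by exists 1; rewrite add0r !mulr1z.
Qed.

(** By maximality, a maximal partial homomorphism containing [D] is defined on all
of [A]. *)
Lemma extend_hom (D : set (A * B)) :
    is_subgroup D -> (forall u, D u -> T u.2) ->
    (forall u, D u -> multiples (p ^ n) u.1 -> u.2 = 0) ->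
  exists f : {additive A -> B},
    (forall x, T (f x)) /\ (forall x y, D (x, y) -> f x = y).
Proof.
move=> sD DT D0; have hD : partial_hom D by [].
have [F FP Ftot|M [hM Mmax]] :=
    @Zorn_bigcup _ [set M | partial_hom (D `|` M)].
  exact: partial_hom_chain.
have [sE ET E0] := hM.
have /choice[f fE] a : exists t, (D `|` M) (a, t).
  have [E [hE DME [t Et]]] := partial_hom_step a hM.
  exists t; right; apply: contrapT => Mt; apply: (Mmax E).
    by split=> [u Mu|EM]; [apply: DME; right|apply: Mt; exact: EM].
  rewrite /=; have -> : D `|` E = E; last exact: hE.
  by apply/setUidPr => u Du; apply: DME; left.
have uniq_val x y : (D `|` M) (x, y) -> f x = y.
  move=> Exy; apply/eqP; rewrite -subr_eq0; apply/eqP.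
  apply: (E0 (x - x, f x - y)); first exact: (sE.2 _ _ (fE x) Exy).
  by exists 0; rewrite mul0rn /= subrr.
have f_additive : zmod_morphism f.
  by move=> x y; apply: uniq_val; exact: (sE.2 _ _ (fE x) (fE y)).
pose addf := GRing.isZmodMorphism.Build A B f f_additive.
pose g : {additive A -> B} := HB.pack f addf.
exists g; split=> [x|x y Dxy]; first exact: (ET _ (fE x)).
by apply: uniq_val; left.
Qed.

End Extension.

(** * Direct summands of unbounded order *)

(** The element [c] has order [p ^ m] and generates a subgroup that meets
[p ^ m A] trivially; such a subgroup is a direct summand. *)
Definition pure_gen (A : zmodType) (p m : nat) (c : A) : Prop :=
  [/\ (0 < m)%N, c *+ (p ^ m) = 0 & ~ multiples (p ^ m) (c *+ (p ^ m.-1))].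

Lemma pure_gen_dvd (A : zmodType) p m (c : A) (a : int) : prime p ->
  pure_gen p m c -> multiples (p ^ m) (c *~ a) -> ((p ^ m)%:Z %| a)%Z.
Proof.
move=> p_prime [m0 _ cN] ca.
have [i [r [q [im ia rq]]]] := bezout_prime_pow m a p_prime.
move: im; rewrite leq_eqVlt => /predU1P[<-//|im]; case: cN.
have sM := @multiples_subgroup A (p ^ m).
have -> : c *+ p ^ m.-1 = (c *+ p ^ i) *+ p ^ (m.-1 - i).
  by rewrite -mulrnA -expnD subnKC // -ltnS prednK.
apply: (subgroupMn sM); rewrite pmulrn -rq mulrzDr [r * a]mulrC !mulrzA.
apply: (subgroupD sM); first exact: subgroupMz.
by exists (c *~ q); rewrite pmulrn.
Qed.

(** The homomorphism is first prescribed on the sum of the group generated by [c']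
and the elements [w] killed by [p ^ (m' - m)].  The extension theorem applies because
[a c' + w] in [p ^ m A] gives [p ^ (m' - m) a c'] in [p ^ m' A], hence [p ^ m]
divides [a] and [a c = 0]. *)
Lemma hom_to_smaller_gen (A : zmodType) p m m' (c c' : A) : prime p ->
    pure_gen p m c -> pure_gen p m' c' -> (m <= m')%N ->
  exists f : {additive A -> A}, [/\ forall x, exists a : int, f x = c *~ a,
    f c' = c & forall w, w *+ (p ^ (m' - m)) = 0 -> f w = 0].
Proof.
move=> p_prime gc gc' mm'; have [_ cm _] := gc.
have mulz0 (a : int) : ((p ^ m)%:Z %| a)%Z -> c *~ a = 0.
  by move=> /dvdzP[b ->]; rewrite mulrC mulrzA -pmulrn cm mul0rz.
pose T := [set y | exists a : int, y = c *~ a].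
have sT : is_subgroup T.
  split; first by exists 0; rewrite mulr0z.
  by move=> _ _ [a ->] [b ->]; exists (a - b); rewrite mulrzBr.
have sL := @torsion_layer_subgroup A (p ^ (m' - m)).
pose D := [set u : A * A | exists2 w, torsion_layer (p ^ (m' - m)) w &
             exists a : int, u = (c' *~ a + w, c *~ a)].
have T_hom j y : (j <= m)%N -> T y -> y *+ (p ^ (m - j)) = 0 ->
    exists2 z, T z & y = z *+ (p ^ j).
  move=> jm [a ->]; rewrite pmulrn -mulrzA => ca0.
  have /dvdzP[b aE] : ((p ^ j)%:Z %| a)%Z.
    apply: (dvdz_pow_cancel p_prime jm).
    apply: (pure_gen_dvd p_prime gc); rewrite ca0.
    exact: (multiples_subgroup _ _).1.
  exists (c *~ b); first by exists b.
  by rewrite pmulrn -mulrzA -aE.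
have [|u|u|f [fT fE]] := @extend_hom A A p m T p_prime sT T_hom D.
- split; first by exists 0; [exact: sL.1|exists 0; rewrite !mulr0z addr0].
  move=> _ _ [v Lv [a ->]] [w Lw [b ->]]; exists (v - w); first exact: sL.2.
  exists (a - b); congr pair; last by rewrite mulrzBr.
  by rewrite /= mulrzBr [RHS]addrACA -opprD.
- by move=> [w _ [a ->]]; exists a.
- move=> [w Lw [a ->]] /= [g gE]; apply: mulz0.
  apply: (dvdz_pow_cancel p_prime mm').
  apply: (pure_gen_dvd p_prime gc'); exists g.
  rewrite mulrzA -pmulrn -[c' *~ a](addrK w) gE mulrnBl Lw subr0.
  by rewrite -mulrnA -expnD subnKC.
exists f; split=> [//||w Lw].
  by apply: fE; exists 0; [exact: sL.1|exists 1; rewrite !mulr1z addr0].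
by apply: fE; exists w => //; exists 0; rewrite !mulr0z add0r.
Qed.

Lemma locally_finite_sum (A B : zmodType) (f : nat -> {additive A -> B}) :
    (forall x, exists N, forall k, (N <= k)%N -> f k x = 0) ->
  exists phi : {additive A -> B}, forall x N,
    (forall k, (N <= k)%N -> f k x = 0) -> phi x = \sum_(k < N) f k x.
Proof.
move=> /choice[bound boundP].
pose phi x := \sum_(k < bound x) f k x.
have phiE x N : (forall k, (N <= k)%N -> f k x = 0) ->
    phi x = \sum_(k < N) f k x.
  move=> fN.
  have trunc M M' : (M <= M')%N -> (forall k, (M <= k)%N -> f k x = 0) ->
      \sum_(k < M) f k x = \sum_(k < M') f k x.
    move=> MM' fM; rewrite (big_ord_widen _ (f ^~ x) MM') big_mkcond /=.
    by apply: eq_bigr => k _; case: ltnP => // /fM.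
  rewrite /phi (trunc _ (maxn N (bound x)) (leq_maxr _ _)); last exact: boundP.
  by rewrite -(trunc _ _ (leq_maxl _ _)).
have phi_additive : zmod_morphism phi.
  move=> x y; set N := maxn (bound x) (bound y).
  have Nx k : (N <= k)%N -> f k x = 0.
    by rewrite geq_max => /andP[/boundP].
  have Ny k : (N <= k)%N -> f k y = 0.
    by rewrite geq_max => /andP[_ /boundP].
  rewrite (phiE x N) // (phiE y N) // (phiE (x - y) N) => [|k Nk].
    by rewrite -sumrB; apply: eq_bigr => k _; rewrite raddfB.
  by rewrite raddfB Nx // Ny // subrr.
pose addphi := GRing.isZmodMorphism.Build A B phi phi_additive.
pose g : {additive A -> B} := HB.pack phi addphi.
by exists g.
Qed.

Lemma coprime_torsion0 (A : zmodType) m n (x : A) : coprime m n ->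
  x *+ m = 0 -> x *+ n = 0 -> x = 0.
Proof.
move=> /eqP mn xm xn; have [r [q rq]] := Bezoutz m n.
have e : gcdz m n = 1 by rewrite /gcdz !absz_nat mn.
rewrite -[x]mulr1z -e -rq mulrzDr [r * _]mulrC [q * _]mulrC !mulrzA.
by rewrite -!pmulrn xm xn !mul0rz addr0.
Qed.

(** The orders [p ^ m k] satisfy [m k.+1 > 2 m k], so that [f k] kills all elements
of order dividing [p ^ m k].  This makes the family [f] locally finite and gives
[f k (c i) = 0] for [i <= k].  Hence [phi (c 0) = 0], and [phi (c k.+1)] is [c k]
plus an element of the span of the [c j] with [j < k].  By this triangular shape,
[phi] maps the span of all the [c k] onto itself. *)
Lemma unbounded_socle_string (A : zmodType) p : torsion_group A -> prime p ->
    (forall N, exists2 m, (N < m)%N & exists c : A, pure_gen p m c) ->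
  exists (phi : {additive A -> A}) x, socle_string phi x.
Proof.
move=> torA p_prime unb.
have /choice[next nextP] N :
    exists u : nat * A, (N < u.1)%N /\ pure_gen p u.1 u.2.
  by have [m Nm [c gc]] := unb N; exists (m, c).
pose s := fix s k := if k is l.+1 then next (s l).1.*2 else next 0%N.
pose m k := (s k).1; pose c k := (s k).2.
have gc k : pure_gen p (m k) (c k) by case: k => [|k]; exact: (nextP _).2.
have mS k : ((m k).*2 < m k.+1)%N := (nextP (m k).*2).1.
have le_m i j : (i <= j)%N -> (m i <= m j)%N.
  move=> /subnK <-; elim: (j - i)%N => // d IH.
  by apply: leq_trans (ltnW (mS _)); rewrite -addnn (leq_trans IH) ?leq_addr.
have lt_m k : (k < m k)%N.
  elim: k => [|k IH]; first exact: (nextP 0%N).1.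
  by apply: leq_trans (mS _); rewrite ltnS -addnn (leq_trans IH) ?leq_addr.
have gap k : (m k <= m k.+1 - m k)%N.
  by rewrite leq_subRL ?addnn ?(ltnW (mS k))// le_m.
have /choice[f fP] k :=
  hom_to_smaller_gen p_prime (gc k) (gc k.+1) (le_m _ _ (leqnSn k)).
have f_kills k j w : w *+ (p ^ j) = 0 -> (j <= m k)%N -> f k w = 0.
  move=> wj jk; have [_ _ ->//] := fP k.
  by rewrite -(subnKC (leq_trans jk (gap k))) expnD mulrnA wj mul0rn.
have f_fin x : exists N, forall k, (N <= k)%N -> f k x = 0.
  have [n n0 xn] := torA x.
  have [e [b [nb nE]]] : exists e b, coprime p b /\ n = (b * p ^ e)%N.
    have [b pb nE] := pfactor_coprime p_prime n0.
    by exists (logn p n), b.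
  (* [f k x] is killed by the part of the order of [x] prime to [p], and it lies
     in a cyclic group of [p]-power order. *)
  exists e => k ek.
  have fbx : f k x *+ b = 0.
    rewrite -raddfMn; apply: (f_kills k e).
      by rewrite -mulrnA -nE.
    by rewrite (leq_trans ek) // ltnW.
  apply: (coprime_torsion0 (m := p ^ m k) _ _ fbx); first exact: coprimeXl.
  have [/(_ x)[a ->] _ _] := fP k; have [_ ck _] := gc k.
  by rewrite !pmulrn -mulrzA mulrC mulrzA -pmulrn ck mul0rz.
have [phi phiE] := locally_finite_sum f_fin.
have fc0 i k : (i <= k)%N -> f k (c i) = 0.
  by move=> ik; apply: (f_kills k (m i)); [have [] := gc i|exact: le_m].
have phic0 : phi (c 0%N) = 0.
  by rewrite (phiE _ 0%N) ?big_ord0 // => k _; exact: fc0.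
have phicS k : phi (c k.+1) = \sum_(j < k) f j (c k.+1) + c k.
  rewrite (phiE _ k.+1) => [|j kj]; last exact: fc0.
  by rewrite big_ord_recr /=; have [_ -> _] := fP k.
(* The subgroup generated by the [c k]. *)
pose S := [set y | forall H : set A, is_subgroup H -> (forall k, H (c k)) -> H y].
have Sc k : S (c k) by move=> H _.
have sS : is_subgroup S.
  split=> [H [] //|x y Sx Sy H sH Hc].
  by apply: sH.2; [exact: Sx|exact: Sy].
have [x xS] : exists x, socle_string phi x.
  apply: (@socle_string_of_surj _ _ S (c 0%N)) => //.
  - pose H := [set y | exists2 z, S z & phi z = y].
    have sH : is_subgroup H.
      split; first by exists 0; [exact: sS.1|rewrite raddf0].
      move=> _ _ [u Su <-] [v Sv <-]; exists (u - v); first exact: sS.2.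
      by rewrite raddfB.
    move=> y Sy; apply: (Sy H sH); apply: ltn_ind => k IH.
    have -> : c k = phi (c k.+1) - \sum_(j < k) f j (c k.+1).
      by rewrite phicS addrC addKr.
    apply: sH.2; first by exists (c k.+1).
    have {}IH (j : 'I_k) : H (f j (c k.+1)).
      have [/(_ (c k.+1))[a ->] _ _] := fP j.
      by apply: (subgroupMz sH); exact: IH.
    exact: (subgroup_sum sH).
  - apply/eqP => c0; have [_ _ cN] := gc 0%N; apply: cN.
    by rewrite c0 mul0rn; exact: (multiples_subgroup _ _).1.
by exists phi, x.
Qed.

(** * An infinite layer of the socle *)

(** The subgroup [(p ^ n A)[p]]; the successive quotients of this filtration of
[A[p]] have the Ulm-Kaplansky invariants of finite index of [A] as dimensions. *)
Definition socle_layer (A : zmodType) (p n : nat) : set A :=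
  torsion_layer p `&` multiples (p ^ n).

Definition int_span (V : zmodType) (e : nat -> V) : set V :=
  [set y | exists N, exists a : nat -> int, y = \sum_(k < N) e k *~ a k].

Lemma int_span_subgroup (V : zmodType) (e : nat -> V) : is_subgroup (int_span e).
Proof.
have pad N M (a : nat -> int) : (N <= M)%N ->
    \sum_(k < N) e k *~ a k = \sum_(k < M) e k *~ (if (k < N)%N then a k else 0).
  move=> NM; rewrite (big_ord_widen _ (fun k => e k *~ a k) NM) big_mkcond /=.
  by apply: eq_bigr => k _; case: ltnP => // _; rewrite mulr0z.
split; first by exists 0%N, (fun=> 0); rewrite big_ord0.
move=> _ _ [N [a ->]] [M [b ->]]; exists (maxn N M).
exists (fun k => (if (k < N)%N then a k else 0) - (if (k < M)%N then b k else 0)).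
rewrite (pad _ _ a (leq_maxl N M)) (pad _ _ b (leq_maxr N M)) -sumrB.
by apply: eq_bigr => k _; rewrite mulrzBr.
Qed.

Lemma int_span_gen (V : zmodType) (e : nat -> V) k : int_span e (e k).
Proof.
exists k.+1, (fun i => (i == k)%:R); rewrite big_ord_recr /= eqxx mulr1z.
rewrite big1 ?add0r // => i _; rewrite (ltn_eqF (ltn_ord i)) mulr0z //.
Qed.

Definition indep_mod (A : zmodType) (p m : nat) (x : nat -> A) : Prop :=
  forall N (a : nat -> int), multiples m (\sum_(k < N) x k *~ a k) ->
  forall k, (k < N)%N -> (p%:Z %| a k)%Z.

(** Divisibility of the coefficients by [p ^ j] is improved to [p ^ j.+1], one power
at a time: after division by [p ^ j], multiplication of the relation by
[p ^ (n - j)] turns it into one between the [p ^ n c k]. *)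
Lemma indep_lift (A : zmodType) p n (c : nat -> A) : prime p ->
  indep_mod p (p ^ n.+1) (fun k => c k *+ (p ^ n)) ->
  indep_mod (p ^ n.+1) (p ^ n.+1) c.
Proof.
move=> p_prime ind N a ca.
have sM := @multiples_subgroup A (p ^ n.+1).
suff : forall j, (j <= n.+1)%N -> forall k, (k < N)%N -> ((p ^ j)%:Z %| a k)%Z.
  exact.
elim=> [_ k _|j IH jn k kN]; first by rewrite expn0 dvd1z.
pose b k := (a k %/ (p ^ j)%:Z)%Z.
have abE i : (i < N)%N -> a i = b i * (p ^ j)%:Z.
  by move=> iN; rewrite divzK //; apply: IH => //; exact: ltnW.
rewrite abE // expnS PoszM dvdz_mul //.
apply: (ind N b _ k kN).
have -> : \sum_(i < N) c i *+ p ^ n *~ b i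
    = (\sum_(i < N) c i *~ a i) *+ (p ^ (n - j)).
  rewrite -sumrMnl; apply: eq_bigr => i _; rewrite abE //.
  rewrite !pmulrn -!mulrzA; congr (_ *~ _).
  by rewrite mulrC -mulrA -PoszM -expnD subnKC.
exact: subgroupMn.
Qed.

(** The [c k] span a direct sum of cyclic groups of order [p ^ n.+1] that meets
[p ^ n.+1 A] trivially, so that the shift of this sum extends to [A]. *)
Lemma homogeneous_socle_string (A : zmodType) p n (c : nat -> A) : prime p ->
    (forall k, c k *+ (p ^ n.+1) = 0) ->
    indep_mod p (p ^ n.+1) (fun k => c k *+ (p ^ n)) ->
  exists (phi : {additive A -> A}) x, socle_string phi x.
Proof.
move=> p_prime cp ind; have indc := indep_lift p_prime ind.
pose d k := if k is j.+1 then c j else 0.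
have dp k : d k *+ (p ^ n.+1) = 0 by case: k => [|k] //=; rewrite mul0rn.
have sT := int_span_subgroup c.
have Td k : int_span c (d k) by case: k => [|k]; [exact: sT.1|exact: int_span_gen].
have T_hom j y : (j <= n.+1)%N -> int_span c y -> y *+ (p ^ (n.+1 - j)) = 0 ->
    exists2 z, int_span c z & y = z *+ (p ^ j).
  move=> jn [N [a ->]] y0.
  have da k : (k < N)%N -> ((p ^ j)%:Z %| a k)%Z.
    move=> kN; apply: (dvdz_pow_cancel p_prime jn).
    apply: (indc N (fun k => a k * (p ^ (n.+1 - j))%:Z) _ k kN).
    have -> : \sum_(i < N) c i *~ (a i * (p ^ (n.+1 - j))%:Z) = 0.
      by rewrite -[RHS]y0 -sumrMnl; apply: eq_bigr => i _; rewrite mulrzA.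
    exact: (multiples_subgroup _ _).1.
  exists (\sum_(k < N) c k *~ (a k %/ (p ^ j)%:Z)%Z).
    by exists N, (fun k => (a k %/ (p ^ j)%:Z)%Z).
  rewrite -sumrMnl; apply: eq_bigr => k _.
  by rewrite pmulrn -mulrzA divzK // da.
(* The integral span of the pairs [cd k] is the graph of the shift. *)
pose cd k : A * A := (c k, d k).
have [||u [N [a ->]]|f [_ fE]] :=
    @extend_hom A A p n.+1 _ p_prime sT T_hom (int_span cd).
- exact: int_span_subgroup.
- move=> _ [N [a ->]]; rewrite (raddf_sum snd).
  apply: (subgroup_sum sT) => k; rewrite (raddfMz snd).
  by apply: (subgroupMz sT); exact: Td.
- rewrite (raddf_sum fst) (raddf_sum snd) => caM; apply: big1 => k _.
  rewrite (raddfMz snd) /=; have /dvdzP[b ->] : ((p ^ n.+1)%:Z %| a k)%Z.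
    apply: (indc N a _ k (ltn_ord k)).
    by rewrite (eq_bigr (fun k : 'I_N => (cd k *~ a k).1)) // => i _;
      rewrite (raddfMz fst).
  by rewrite mulrC mulrzA -pmulrn dp mul0rz.
have fc k : f (c k) = d k by apply: fE; exact: (int_span_gen cd).
exists f, c; split=> [||k]; rewrite ?fc //.
apply/eqP => c0; have := @ind 1%N (fun=> 1) _ 0%N isT.
rewrite big_ord1 /= c0 mul0rn mul0rz => /(_ (multiples_subgroup _ _).1).
by rewrite dvdzE /= dvdn1 => /eqP p1; rewrite p1 in p_prime.
Qed.

(** The hypothesis says that the layer [S n / S n.+1] is infinite, in the form in
which it is used: no finite part of [A[p]] represents all its classes.  The next
[x k] is chosen outside the classes of the finite set of combinations of the
previous ones; in a vector space over the field with [p] elements this gives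
independence. *)
Lemma infinite_layer_indep (A : zmodType) p n : prime p ->
    (forall E : set A, finite_set E -> E `<=` torsion_layer p ->
      exists2 x, socle_layer p n x
        & forall e, E e -> ~ multiples (p ^ n.+1) (x - e)) ->
  exists2 x : nat -> A, forall k, socle_layer p n (x k)
    & indep_mod p (p ^ n.+1) x.
Proof.
move=> p_prime inf.
have /choice[pick pickP] : forall E : set A, exists x,
    finite_set E /\ E `<=` torsion_layer p ->
    socle_layer p n x /\ forall e, E e -> ~ multiples (p ^ n.+1) (x - e).
  move=> E; case: (pselect (finite_set E /\ E `<=` torsion_layer p)).
    by move=> [fE Ep]; have [x] := inf E fE Ep; exists x.
  by move=> nE; exists 0 => /nE.
pose span := fix span k : set A := if k is j.+1 then
  [set e + pick (span j) *+ b | e in span j & b in `I_p] else [set 0].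
pose x k := pick (span k).
have sL := @torsion_layer_subgroup A p.
have spanP k : finite_set (span k) /\ span k `<=` torsion_layer p.
  elim: k => [|k [fin sub]] /=.
    by split; [exact: finite_set1|move=> _ ->; exact: sL.1].
  split; first by apply: finite_image2 => //; exact: finite_II.
  move=> _ [e /sub ep [b _ <-]]; apply: (subgroupD sL) => //.
  by apply: (subgroupMn sL); have [[]] := pickP _ (conj fin sub).
have xP k := pickP _ (spanP k).
have xp k : x k *+ p = 0 by have [[]] := xP k.
have xmod k (a b : int) : (p%:Z %| a - b)%Z -> x k *~ a = x k *~ b.
  move=> /dvdzP[q abE]; rewrite -[a](subrK b) abE mulrzDr mulrC mulrzA.
  by rewrite -pmulrn xp mul0rz add0r.
have span_sum N (a : nat -> int) : span N (\sum_(k < N) x k *~ a k).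
  elim: N => [|N IH]; first by rewrite big_ord0.
  rewrite big_ord_recr /=; exists (\sum_(k < N) x k *~ a k) => //.
  have p0 : p%:Z != 0 by rewrite eqz_nat -lt0n prime_gt0.
  exists `|(a N %% p)%Z|%N.
    by rewrite /= -ltz_nat gez0_abs ?modz_ge0 // ltz_pmod // ltz_nat prime_gt0.
  rewrite pmulrn gez0_abs ?modz_ge0 //; congr (_ + _); apply/esym/xmod.
  by rewrite {1}(divz_eq (a N) p) addrK dvdz_mull.
exists x => [k|]; first by have [] := xP k.
elim=> // N IH a; rewrite big_ord_recr /= => hM k.
have pN : (p%:Z %| a N)%Z.
  apply/negPn/negP => npa.
  have [r [q rq]] : exists r q, r * a N + q * p%:Z = 1.
    have [r [q rq]] := Bezoutz (a N) p%:Z; exists r, q; rewrite rq.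
    apply/eqP; rewrite -[_ == 1]/(coprimez _ _) coprimez_sym coprimezE /=.
    by rewrite prime_coprime.
  (* The relation is scaled so that [x N] gets coefficient 1. *)
  have [_ /(_ _ (span_sum N (fun k => - (r * a k))))] := xP N; apply.
  have -> : pick (span N) - \sum_(i < N) x i *~ - (r * a i)
      = (\sum_(i < N) x i *~ a i + x N *~ a N) *~ r.
    rewrite mulrzDl addrC; congr (_ + _).
      rewrite -sumrN mulrz_suml; apply: eq_bigr => i _.
      by rewrite mulrNz opprK mulrC mulrzA.
    rewrite -mulrzA -[LHS]mulr1z; apply: xmod.
    by rewrite -rq [a N * r]mulrC addrAC subrr add0r dvdz_mull.
  exact: (subgroupMz (multiples_subgroup _ _)).
have xN0 : x N *~ a N = 0 by rewrite (@xmod N _ 0) ?mulr0z // subr0.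
rewrite ltnS leq_eqVlt => /predU1P[->//|]; apply: IH.
by rewrite xN0 addr0 in hM.
Qed.

(** * A divisible component *)

(** Once every element of [(p ^ n A)[p]] lies in [p ^ n.+1 A] for all [n >= N], the
[p]-component of [p ^ N A] is divisible by [p]: for [y] of order [p ^ k.+1],
the element [p ^ k y] lies in [(p ^ (N + k) A)[p]], so it is of the form
[p ^ (N + k).+1 h], and [y - p ^ N.+1 h] has smaller order. *)
Lemma divisible_socle_string (A : zmodType) p N (x0 : A) :
    (forall n, (N <= n)%N -> @socle_layer A p n `<=` multiples (p ^ n.+1)) ->
    socle_layer p N x0 -> x0 != 0 ->
  exists (phi : {additive A -> A}) x, socle_string phi x.
Proof.
move=> stable [x0p x0N] x0N0.
pose phi (x : A) := x *+ p.
have phi_additive : zmod_morphism phi by move=> x y; exact: mulrnBl.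
pose addphi := GRing.isZmodMorphism.Build A A phi phi_additive.
pose mulp : {additive A -> A} := HB.pack phi addphi.
exists mulp.
have sM := @multiples_subgroup A (p ^ N).
apply: (@socle_string_of_surj _ _ (p_component p `&` multiples (p ^ N)) x0) => //.
  move=> y [[k yk] yN].
  suff [z zN zy] : exists2 z, multiples (p ^ N) z & z *+ p = y.
    exists z => //; split=> //; exists k.+1.
    by rewrite expnS mulrnA zy.
  elim: k y yk yN => [|k IH] y yk yN.
    exists 0; first exact: sM.1.
    by move: yk; rewrite expn0 mulr1n mul0rn => ->.
  have [|h hE] := stable (N + k)%N (leq_addr _ _) (y *+ p ^ k).
    split; first by rewrite /torsion_layer /= -mulrnA -expnSr.
    by rewrite expnD; exact: multiplesMn.
  have [||z zN zE] := IH (y - h *+ p ^ N.+1).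
  - by rewrite mulrnBl hE -mulrnA -expnD addSn subrr.
  - apply: sM.2 => //; exists (h *+ p).
    by rewrite -mulrnA -expnS.
  exists (z + h *+ p ^ N); first by apply: (subgroupD sM) => //; exists h.
  by rewrite mulrnDl zE -mulrnA -expnSr subrK.
by split=> //; exists 1%N; rewrite expn1.
Qed.

(** * Endomorphisms of groups with an infinite primary component *)

(** If no socle string exists, each of the three constructions fails: the layers of
[A[p]] are finite, and the filtration is constant from some [N] on, with value
zero.  So [A[p]] is finite, and an element of the [p]-component is killed by
[p ^ N]. *)
Lemma infinite_p_component_socle_string (A : zmodType) p :
    torsion_group A -> prime p -> infinite_set (@p_component A p) ->
  exists (phi : {additive A -> A}) x, socle_string phi x.
Proof.
move=> torA p_prime infp; apply: contrapT => none; apply: infp.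
have sL := @torsion_layer_subgroup A p.
have finite_quotient n : exists E : set A, [/\ finite_set E,
    E `<=` torsion_layer p & forall x, socle_layer p n x ->
      exists2 e, E e & multiples (p ^ n.+1) (x - e)].
  apply: contrapT => noE; apply: none.
  have [E fE Ep|x xP ind] := @infinite_layer_indep A p n p_prime.
    apply: contrapT => noX; apply: noE; exists E; split=> // x xn.
    apply: contrapT => noe; apply: noX; exists x => // e Ee xe.
    by apply: noe; exists e.
  have /choice[c cE] k : exists c, x k = c *+ (p ^ n) by have [] := xP k.
  apply: (@homogeneous_socle_string A p n c) => // [k|].
    by rewrite expnSr mulrnA -cE; have [] := xP k.
  by under eq_fun do rewrite -cE.
have [N stable] : exists N, forall n, (N <= n)%N ->
    @socle_layer A p n `<=` multiples (p ^ n.+1).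
  apply: contrapT => unb; apply: none.
  apply: (unbounded_socle_string torA p_prime) => N.
  apply: contrapT => noc; apply: unb; exists N => n Nn x [xp [c xE]].
  apply: contrapT => nx; apply: noc; exists n.+1 => //; exists c; split=> //.
    by rewrite expnSr mulrnA -xE.
  by rewrite /= -xE.
have socN (x : A) : socle_layer p N x -> x = 0.
  move=> xN; apply: contrapT => /eqP x0; apply: none.
  exact: (divisible_socle_string stable xN x0).
have fin_soc n : (n <= N)%N -> finite_set (@socle_layer A p (N - n)).
  elim: n => [_|n IH nN].
    by apply: sub_finite_set (finite_set1 0) => x; rewrite subn0 => /socN.
  have [E [fE Ep EP]] := finite_quotient (N - n.+1)%N.
  have := finite_image2 +%R fE (IH (ltnW nN)).
  apply: sub_finite_set => x xn; have [e Ee xe] := EP x xn.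
  exists e => //; exists (x - e); last by rewrite addrC subrK.
  rewrite -subSn // subSS in xe; split=> //.
  by apply: sL.2; [have [] := xn|exact: Ep].
have fin_p : finite_set (@torsion_layer A p).
  apply: sub_finite_set (fin_soc N (leqnn N)) => x xp.
  by rewrite subnn; split=> //; exists x; rewrite expn0 mulr1n.
apply: sub_finite_set (finite_torsion_layer_pow N fin_p) => x [k].
move=> xk; have {xk} : x *+ p ^ (N + k) = 0.
  by rewrite addnC expnD mulrnA xk mul0rn.
elim: k => [|k IH] xk; first by rewrite addn0 in xk.
apply: IH; apply: socN; split; last first.
  by exists (x *+ p ^ k); rewrite -mulrnA -expnD addnC.
by rewrite /torsion_layer /= -mulrnA -expnSr -addnS.
Qed.

(** * Groups with finite primary components *)

Lemma prime_order_multiple (A : zmodType) (y : A) : torsion_group A -> y != 0 ->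
  exists p d, [/\ prime p, y *+ d != 0 & y *+ d *+ p = 0].
Proof.
move=> torA yN0.
have ex : exists m, (0 < m)%N && (y *+ m == 0).
  by have [m m0 /eqP ym] := torA y; exists m; rewrite m0.
case: (ex_minnP ex) => m /andP[m0 /eqP ym] mmin.
have m1 : (1 < m)%N.
  case: (ltngtP m 1) => // [|e]; first by case: m m0 {ym mmin}.
  by move: yN0; rewrite -[y]mulr1n -e ym eqxx.
exists (pdiv m), (m %/ pdiv m)%N; split; first exact: pdiv_prime.
  apply/eqP => yd; have := mmin (m %/ pdiv m)%N.
  rewrite divn_gt0 ?pdiv_gt0 // pdiv_leq // yd eqxx => /(_ isT).
  by rewrite leqNgt ltn_Pdiv // prime_gt1 // pdiv_prime.
by rewrite -mulrnA divnK // pdiv_dvd.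
Qed.

(** The multiple is the projection onto the [p]-component up to a factor that is 1
modulo [p], so that it fixes elements of order [p]. *)
Lemma p_component_multiple (A : zmodType) p (z : A) : torsion_group A ->
  prime p -> exists2 m, m = 1 %[mod p] & p_component p (z *+ m).
Proof.
move=> torA p_prime; have [n n0 zn] := torA z.
have [b pb nE] := pfactor_coprime p_prime n0.
exists (chinese p b 1 0)%N; first exact: chinese_modl.
exists (logn p n).
have /dvdnP[c ->] : (b %| chinese p b 1 0)%N.
  by rewrite /dvdn chinese_modr // mod0n.
by rewrite -mulrnA -mulnA -nE mulnC mulrnA zn mul0rn.
Qed.

(** The elements [N x_n], with [N] killing [x 0], form a sequence of successive
preimages of 0.  Its first nonzero term, if there is one, has a multiple [z] of
prime order [p] which has preimages [w k] under all iterates of [phi], and these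
can be taken in the [p]-component. *)
Lemma no_string (A : zmodType) (phi : {additive A -> A}) x :
    torsion_group A -> (forall p, prime p -> finite_set (@p_component A p)) ->
  ~ is_string phi x.
Proof.
move=> torA finp [x_inj xS].
have not_fin (S : set A) (w : nat -> A) : injective w -> (forall n, S (w n)) ->
    ~ finite_set S.
  move=> w_inj Sw fin; apply: infinite_nat.
  by apply: sub_finite_set (finite_preimage (in2W w_inj) fin) => n _; exact: Sw.
have [N N0 xN] := torA (x 0%N).
suff xNn n : torsion_layer N (x n).
  by apply: (not_fin _ x x_inj xNn); exact: finite_torsion_layer.
rewrite /torsion_layer /=; elim: n => [//|n IH].
apply/eqP/negPn/negP => yN0.
have [p [d [p_prime zN0 zp]]] := prime_order_multiple torA yN0.
set z := _ *+ d in zN0 zp.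
have phiz : phi z = 0 by rewrite !raddfMn xS IH mul0rn.
have preim k : exists2 w, p_component p w & iter k phi w = z.
  have [m mp pm] := p_component_multiple (x (n.+1 + k)%N *+ N *+ d) torA p_prime.
  exists (x (n.+1 + k)%N *+ N *+ d *+ m) => //.
  rewrite !iter_additiveMn (iter_string xS) -/z (divn_eq m p) mp.
  by rewrite modn_small ?prime_gt1 // mulrnDr mulnC mulrnA zp mul0rn add0r mulr1n.
have /choice[w wP] k : exists w, p_component p w /\ iter k phi w = z.
  by have [w] := preim k; exists w.
apply: (not_fin (p_component p) w _ (fun k => (wP k).1)); last exact: finp.
exact: (iterated_preimage_inj zN0 phiz (fun k => (wP k).2)).
Qed.

(** * The string numbers of a group and of its subgroups *)

Section StringNumbers.
Variable R : realType.
Implicit Type A : zmodType.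
Local Open Scope ereal_scope.

Lemma disjoint_family0 (T : Type) (P : set (nat -> T)) : disjoint_family P set0.
Proof. by split=> // f g []. Qed.

Lemma counting0 (T : choiceType) : @counting T R set0 = 0.
Proof. by rewrite /counting asboolT ?fset_set0 //; exact: finite_set0. Qed.

Lemma s0_ge0 A : 0 <= s0 R A.
Proof.
have idA : [set: {additive A -> A}] idfun by [].
apply: le_trans (ereal_sup_ubound (imageP _ idA)).
apply: ereal_sup_ubound; exists set0; last exact: counting0.
exact: disjoint_family0.
Qed.

Lemma s0_le_s A : s0 R A <= s R A.
Proof.
apply: ge_ereal_sup => _ [phi _ <-].
apply: le_trans (ereal_sup_ubound (imageP _ (I : setT phi))).
apply: le_ereal_sup => _ [F [FP Fdisj] <-]; exists F => //.
by split=> // x /FP[].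
Qed.

Lemma s_le0 A : torsion_group A ->
  (forall p, prime p -> finite_set (@p_component A p)) -> s R A <= 0.
Proof.
move=> torA finA; apply: ge_ereal_sup => _ [phi _ <-].
apply: ge_ereal_sup => _ [F [FP _] <-].
suff -> : F = set0 by rewrite counting0.
by rewrite -subset0 => x /FP /(no_string torA finA).
Qed.

Lemma s0_pinfty A p : torsion_group A -> prime p ->
  infinite_set (@p_component A p) -> s0 R A = +oo.
Proof.
move=> torA p_prime infA.
have [phi [x sx]] := infinite_p_component_socle_string torA p_prime infA.
apply/eqP; rewrite -leye_eq -(null_string_number_pinfty R sx).
exact: (ereal_sup_ubound (imageP _ (I : setT phi))).
Qed.

End StringNumbers.

Section Subgroup.
Variables (G : zmodType) (H : zmodClosed G).

Lemma subgroup_torsion : torsion_group G -> torsion_group (subgroup H).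
Proof.
move=> torG x; have [n n0 xn] := torG (val x); exists n => //.
by apply: val_inj; rewrite raddfMn raddf0.
Qed.

Lemma p_component_val p (x : subgroup H) :
  p_component p x <-> p_component p (val x).
Proof.
split=> -[k xk]; exists k; first by rewrite -raddfMn xk raddf0.
by apply: val_inj; rewrite raddfMn xk raddf0.
Qed.

Lemma subgroup_p_component_finite p :
  finite_set (@p_component G p) -> finite_set (@p_component (subgroup H) p).
Proof.
move=> fin; apply: sub_finite_set (finite_preimage (in2W val_inj) fin) => x.
by move/p_component_val.
Qed.

Lemma full_subgroup_p_component_infinite p : (forall x, x \in H) ->
  infinite_set (@p_component G p) -> infinite_set (@p_component (subgroup H) p).
Proof.
move=> fullH infG fin; apply: infG.
apply: sub_finite_set (finite_image val fin) => x px.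
by exists (Sub x (fullH x)); rewrite ?SubK //; apply/p_component_val; rewrite SubK.
Qed.

End Subgroup.

Lemma exists_full_zmodClosed (G : zmodType) :
  exists H : zmodClosed G, forall x, x \in H.
Proof.
pose P : {pred G} := predT.
have P_closed : zmod_closed P by split.
pose mix := GRing.isZmodClosed.Build G P P_closed.
pose H : zmodClosed G := HB.pack P mix.
by exists H.
Qed.

Theorem lemma7p2 (R : realType) (G : zmodType) (tG : torsion_group G) :
  [<-> tilde_s R G = 0%E;
       tilde_s0 R G = 0%E;
       s R G = 0%E;
       s0 R G = 0%E;
       forall p : nat, prime p -> finite_set (@p_component G p)]
  /\ tilde_s R G = tilde_s0 R G.
Proof.
have tilde_ge (H : zmodClosed G) :
    (s R (subgroup H) <= tilde_s R G)%E /\ (s0 R (subgroup H) <= tilde_s0 R G)%E.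
  by split; apply: ereal_sup_ubound; exists H.
have [Hfull fullP] := exists_full_zmodClosed G.
case: (pselect (forall p, prime p -> finite_set (@p_component G p))) => finG.
  have sub_le0 (H : zmodClosed G) : (s R (subgroup H) <= 0)%E.
    apply: s_le0; first exact: subgroup_torsion.
    by move=> p /finG; exact: subgroup_p_component_finite.
  have sG : s R G = 0%E.
    by apply/eqP; rewrite eq_le s_le0 //= (le_trans (s0_ge0 R G)) // s0_le_s.
  have s0G : s0 R G = 0%E by apply/eqP; rewrite eq_le s0_ge0 andbT -sG s0_le_s.
  have tsG : tilde_s R G = 0%E.
    apply/eqP; rewrite eq_le; apply/andP; split.
      by apply: ge_ereal_sup => _ [H _ <-].
    apply: le_trans (tilde_ge Hfull).1.
    by apply: le_trans (s0_ge0 _ _) (s0_le_s _ _).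
  have ts0G : tilde_s0 R G = 0%E.
    apply/eqP; rewrite eq_le; apply/andP; split.
      by apply: ge_ereal_sup => _ [H _ <-]; exact: le_trans (s0_le_s _ _) _.
    exact: le_trans (s0_ge0 _ _) (tilde_ge Hfull).2.
  by split; [tfae|rewrite tsG].
have [p [p_prime infp]] :
    exists p, prime p /\ infinite_set (@p_component G p).
  apply: contrapT => none; apply: finG => p p_prime; apply: contrapT => infp.
  by apply: none; exists p.
have s0G := s0_pinfty R tG p_prime infp.
have sG : s R G = +oo%E by apply/eqP; rewrite -leye_eq -s0G s0_le_s.
(* The group [G] is isomorphic to its full subgroup, whose [p]-component is
   therefore infinite as well. *)
have s0H : s0 R (subgroup Hfull) = +oo%E.
  apply: (s0_pinfty _ _ p_prime); first exact: subgroup_torsion.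
  exact: full_subgroup_p_component_infinite.
have ts0G : tilde_s0 R G = +oo%E.
  by apply/eqP; rewrite -leye_eq -s0H (tilde_ge Hfull).2.
have tsG : tilde_s R G = +oo%E.
  apply/eqP; rewrite -leye_eq -s0H (le_trans (s0_le_s _ _)) //.
  exact: (tilde_ge Hfull).1.
by split; [tfae; rewrite ?tsG ?ts0G ?sG ?s0G|rewrite tsG].
Qed.
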